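(* A curve $A\in C^0(\mathbb{R},\mathrm{SL}(2,\mathbb{R}))\cap C^2(\mathbb{R},\mathbb{M}^2)$ is a geodesic in $\mathrm{SL}(2,\mathbb{R})$ with the induced Euclidean metric if and only if there is a continuous function $\lambda:\mathbb{R}\to\mathbb{R}$ such that $\ddot A(t)=\lambda(t)\,\mathrm{cof}\,A(t)$ for all $t\in\mathbb{R}$.
   Context: $\mathbb{M}^2$ is the space of real $2\times2$ matrices with the Euclidean inner product $\langle A,B\rangle=\mathrm{tr}(A^\top B)$. $\mathrm{SL}(2,\mathbb{R})=\{A\in\mathbb{M}^2:\det A=1\}$ is regarded as an embedded submanifold of $\mathbb{M}^2$ with the Riemannian metric induced from this inner product. $\mathrm{cof}\,A=ZAZ^\top$, with $Z=\begin{bmatrix}0&-1\\1&0\end{bmatrix}$, is the cofactor matrix. A geodesic is a curve whose velocity $\dot A$ is parallel along it, i.e. the covariant derivative of $\dot A$ along $A$ (the orthogonal projection of $\ddot A(t)$ onto $T_{A(t)}\mathrm{SL}(2,\mathbb{R})$) vanishes for all $t$; constant curves are included as geodesics. *)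

(* Defs.v *)
From HB Require Import structures.
From mathcomp Require Import all_boot all_order all_algebra.
From mathcomp Require Import all_classical all_reals all_analysis.

Set Implicit Arguments.
Unset Strict Implicit.
Unset Printing Implicit Defensive.

Import Order.TTheory GRing.Theory Num.Theory.
Import numFieldNormedType.Exports.

Local Open Scope ring_scope.
Local Open Scope classical_set_scope.

(* [derive1n] is total, so differentiability of every lower-order derivative
   has to be required explicitly. *)
Definition is_Ck (R : realType) (V : normedModType R) (k : nat) (f : R -> V) :
    Prop :=
  (forall i, (i < k)%N -> forall t, derivable (f^`(i)) t 1) /\
  (forall i, (i <= k)%N -> continuous (f^`(i))).

Definition smooth_on_ball (R : realType) (V : normedModType R) (e : R)
    (f : R -> V) : Prop :=
  forall (i : nat) (t : R), `|t| < e -> derivable (f^`(i)) t 1.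

(* Tangent space at [p] of an embedded submanifold [M] of a normed space:
   initial velocities of smooth curves in [M] issued from [p].  Only the
   restriction of [c] to ]-e, e[ matters. *)
Definition tangent_space (R : realType) (V : normedModType R) (M : set V)
    (p : V) : set V :=
  [set v | exists (e : R) (c : R -> V),
     [/\ 0 < e,
         smooth_on_ball e c,
         forall t, `|t| < e -> M (c t),
         c 0 = p
       & derive1 c 0 = v]].

Definition frobenius (R : realType) (A B : 'M[R]_2) : R := \tr (A^T *m B).

Definition is_orth_proj (R : realType) (T : set 'M[R]_2) (X P : 'M[R]_2) :
    Prop :=
  T P /\ forall B, T B -> frobenius (X - P) B = 0.

Definition SL2 {R : realType} : set 'M[R]_2 := [set A | \det A = 1].

(* [D] is the value at time [t] of the covariant derivative, for the metric
   induced on [M] by the Frobenius inner product, of the vector field [X]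
   along the curve [A]. *)
Definition is_covariant_derivative (R : realType) (M : set 'M[R]_2)
    (A X : R -> 'M[R]_2) (t : R) (D : 'M[R]_2) : Prop :=
  is_orth_proj (tangent_space M (A t)) (derive1 X t) D.

Definition parallel_along (R : realType) (M : set 'M[R]_2)
    (A X : R -> 'M[R]_2) : Prop :=
  forall t, is_covariant_derivative M A X t 0.

Definition geodesic (R : realType) (M : set 'M[R]_2) (A : R -> 'M[R]_2) :
    Prop :=
  parallel_along M A (derive1 A).

Definition Zmx (R : realType) : 'M[R]_2 :=
  \matrix_(i, j) nth 0 (nth [::] [:: [:: 0; -1]; [:: 1; 0]] i) j.

Definition cof (R : realType) (A : 'M[R]_2) : 'M[R]_2 :=
  Zmx R *m A *m (Zmx R)^T.

(* Main.v *)
Require Import Defs.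
From mathcomp Require Import all_boot all_order all_algebra.
From mathcomp Require Import all_classical all_reals all_analysis.
From mathcomp Require Import ring.
Import Order.TTheory GRing.Theory Num.Theory.
Import numFieldNormedType.Exports.
Local Open Scope ring_scope.
Local Open Scope classical_set_scope.

(** Why the equivalence holds.  The differential of the determinant at [A] is
    [B |-> <cof A, B>], so the determinant being constant on [SL2] makes every
    tangent vector at [A] orthogonal to [cof A]
    ([tangent_SL2_orth_cof]).  Hence an acceleration that is a multiple of
    [cof A] has zero tangential part.

    For the converse it is not necessary to know the whole tangent space, but
    only enough of it to span the orthogonal complement of [cof A].  If [X] is a
    nilpotent 2 x 2 matrix, that is [\tr X = 0] and [\det X = 0], then
    [t |-> A (1 + t X)] is a straight line contained in [SL2], so [A X] is
    tangent at [A] ([tangent_SL2_nilpotent]).  Three nilpotent matrices span the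
    traceless matrices, so a matrix [Y] that is orthogonal to all tangent
    vectors has [A^T Y] scalar; as [cof A] is the inverse of [A^T], this says
    [Y = mu *: cof A], where [mu] is the top left entry of [A^T Y]
    ([orth_tangent_SL2]).  With [Y] the acceleration, this formula for [mu] is
    polynomial in the entries of the curve and of its second derivative, and
    so it is continuous in time. *)

Lemma ord2_ind (P : 'I_2 -> Prop) : P 0 -> P 1 -> forall i, P i.
Proof.
move=> P0 P1 [[|[|//]] lti].
- by have -> : Ordinal lti = 0 by exact: val_inj.
- by have -> : Ordinal lti = 1 by exact: val_inj.
Qed.

Lemma sum_ord2 (R : nmodType) (F : 'I_2 -> R) : \sum_i F i = F 0 + F 1.
Proof.
rewrite !big_ord_recl big_ord0 addr0; congr (F _ + F _); exact: val_inj.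
Qed.

Lemma det2 (R : comNzRingType) (A : 'M[R]_2) :
  \det A = A 0 0 * A 1 1 - A 0 1 * A 1 0.
Proof.
have l0 : lift (0 : 'I_2) (0 : 'I_1) = 1 by exact: val_inj.
have l1 : lift (1 : 'I_2) (0 : 'I_1) = 0 by exact: val_inj.
rewrite (expand_det_row _ 0) sum_ord2 /cofactor !det_mx11 !mxE l0 l1 /=.
by rewrite expr0 expr1; ring.
Qed.

Lemma frobenius2 (R : realType) (A B : 'M[R]_2) :
  frobenius A B =
  A 0 0 * B 0 0 + A 0 1 * B 0 1 + (A 1 0 * B 1 0 + A 1 1 * B 1 1).
Proof. by rewrite /frobenius /mxtrace !(sum_ord2, mxE); ring. Qed.

Lemma frobenius_mulmxr (R : realType) (A Y X : 'M[R]_2) :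
  frobenius Y (A *m X) = frobenius (A^T *m Y) X.
Proof. by rewrite /frobenius trmx_mul trmxK mulmxA. Qed.

Lemma frobeniusZl (R : realType) (k : R) (A B : 'M[R]_2) :
  frobenius (k *: A) B = k * frobenius A B.
Proof. by rewrite !frobenius2 !mxE; ring. Qed.

Lemma cofE (R : realType) (A : 'M[R]_2) :
  [/\ cof A 0 0 = A 1 1, cof A 0 1 = - A 1 0,
      cof A 1 0 = - A 0 1 & cof A 1 1 = A 0 0].
Proof. by rewrite /cof /Zmx; split; rewrite !(sum_ord2, mxE) /=; ring. Qed.

(** In particular [cof A] is the inverse of [A^T] when [\det A = 1]. *)
Lemma cof_mul_tr (R : realType) (A : 'M[R]_2) :
  cof A *m A^T = (\det A)%:M.
Proof.
have [c00 c01 c10 c11] := cofE R A.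
by apply/matrixP; apply: ord2_ind; apply: ord2_ind;
  rewrite !(sum_ord2, mxE) ?(c00, c01, c10, c11) det2 /=; ring.
Qed.

Lemma det_add1Z (R : comNzRingType) (t : R) (X : 'M[R]_2) :
  \det (1%:M + t *: X) = 1 + t * \tr X + t ^+ 2 * \det X.
Proof. by rewrite !det2 /mxtrace sum_ord2 !mxE /=; ring. Qed.

Lemma is_derive_affine (R : realType) (V : normedModType R) (p v : V) (t : R) :
  is_derive t 1 (fun s : R => p + s *: v) v.
Proof.
have -> : (fun s : R => p + s *: v) = cst p + (fun s : R => s *: v) by [].
apply: DeriveDef.
  by apply: derivableD => //; exact/derivable1_diffP.
rewrite deriveD//; last exact/derivable1_diffP.
by rewrite derive_cst add0r deriveE// diff_val scale1r.
Qed.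

Lemma smooth_affine (R : realType) (V : normedModType R) (p v : V) (e : R) :
  smooth_on_ball e (fun s : R => p + s *: v).
Proof.
have d1 : (fun s : R => p + s *: v)^`() = cst v.
  apply/funext => s; rewrite derive1E.
  by have [_ ->] := is_derive_affine R V p v s.
have dS i : (fun s : R => p + s *: v)^`(i.+2) = cst 0.
  elim: i => [|i IH]; rewrite derive1nS; last first.
    by rewrite IH; apply/funext => s; rewrite derive1_cst.
  by rewrite derive1n1 d1; apply/funext => s; rewrite derive1_cst.
move=> [|[|i]] t _.
- by have [] := is_derive_affine R V p v t.
- by rewrite derive1n1 d1; exact: derivable_cst.
- by rewrite dS; exact: derivable_cst.
Qed.

(** A straight line contained in [M] has its direction tangent to [M]; no other
    curve is needed to produce tangent vectors. *)
Lemma tangent_line (R : realType) (M : set 'M[R]_2) (p v : 'M[R]_2) :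
  (forall t : R, M (p + t *: v)) -> tangent_space M p v.
Proof.
move=> Mpv; exists 1, (fun t => p + t *: v); split => //.
- exact: smooth_affine.
- by rewrite scale0r addr0.
- by rewrite derive1E; have [_ ->] := is_derive_affine R _ p v 0.
Qed.

Lemma tangent_SL2_nilpotent (R : realType) (A X : 'M[R]_2) :
  SL2 A -> \tr X = 0 -> \det X = 0 -> tangent_space SL2 A (A *m X).
Proof.
move=> detA trX detX; apply: tangent_line => t; rewrite /SL2 /=.
rewrite -{1}[A]mulmx1 scalemxAr -mulmxDr det_mulmx detA det_add1Z trX detX.
by rewrite !mulr0 !addr0 mulr1.
Qed.

Lemma tangent_SL2_orth_cof (R : realType) (A B : 'M[R]_2) :
  tangent_space SL2 A B -> frobenius (cof A) B = 0.
Proof.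
move=> [e [c [e0 smc cSL2 <- <-]]].
have dc : derivable c 0 1 by apply: (smc 0%N); rewrite normr0.
have dcij i j : is_derive (0 : R) 1 (fun t => c t i j) (c^`() 0 i j).
  apply: DeriveDef; first exact: (derivable_mxP c 0 1).1.
  by rewrite derive1E derive_mx// mxE.
(* The determinant is 1 near time 0, so its derivative there vanishes. *)
have ddet : is_derive (0 : R) 1
    ((fun t => c t 0 0) * (fun t => c t 1 1) -
     (fun t => c t 0 1) * (fun t => c t 1 0)) 0.
  apply: (@near_eq_is_derive R R R (cst 1)).
  near=> t; rewrite /cst /=.
  have <- : \det (c t) = 1.
    apply: cSL2; near: t; apply/nbhs_ballP; exists e => // t.
    by rewrite /ball /= sub0r normrN.
  by rewrite det2.
have [c00 c01 c10 c11] := cofE R (c 0).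
have [_ ddet0] := ddet.
have [_] := is_deriveB (is_deriveM (dcij 0 0) (dcij 1 1))
                       (is_deriveM (dcij 0 1) (dcij 1 0)).
rewrite ddet0 frobenius2 c00 c01 c10 c11 => /esym E.
rewrite -[RHS]E /GRing.scale /=; ring.
Unshelve. all: by end_near.
Qed.

(** A vector normal to [SL2] at [A] is a multiple of [cof A]; the explicit
    coefficient makes its continuous dependence on [A] and [Y] visible. *)
Lemma orth_tangent_SL2 (R : realType) (A Y : 'M[R]_2) :
  SL2 A -> (forall B, tangent_space SL2 A B -> frobenius Y B = 0) ->
  Y = (A^T *m Y) 0 0 *: cof A.
Proof.
move=> detA orthY; have [W WE] : exists W, W = A^T *m Y by exists (A^T *m Y).
rewrite -WE.
have orthW X : \tr X = 0 -> \det X = 0 -> frobenius W X = 0.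
  move=> trX detX; rewrite WE -frobenius_mulmxr.
  by apply: orthY; exact: tangent_SL2_nilpotent.
have W01 : W 0 1 = 0.
  rewrite -[RHS](orthW (delta_mx 0 1)) ?frobenius2 ?det2 /mxtrace ?sum_ord2;
  by rewrite !mxE /=; ring.
have W10 : W 1 0 = 0.
  rewrite -[RHS](orthW (delta_mx 1 0)) ?frobenius2 ?det2 /mxtrace ?sum_ord2;
  by rewrite !mxE /=; ring.
have W11 : W 1 1 = W 0 0.
  (* Both rows of this nilpotent matrix are (1, -1). *)
  have : frobenius W (\matrix_(i, j) (-1) ^+ j) = 0.
    by apply: orthW; rewrite ?det2 /mxtrace ?sum_ord2 !mxE /=; ring.
  rewrite frobenius2 !mxE /= W01 W10 => E.
  by apply/esym/eqP; rewrite -subr_eq0 -[X in _ == X]E; apply/eqP; ring.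
have Wscalar : W = (W 0 0)%:M.
  by apply/matrixP; apply: ord2_ind; apply: ord2_ind; rewrite !mxE.
rewrite -mul_mx_scalar -Wscalar WE mulmxA cof_mul_tr.
by rewrite (detA : \det A = 1) mul1mx.
Qed.

Lemma tangent_SL2_0 (R : realType) (A : 'M[R]_2) :
  SL2 A -> tangent_space SL2 A 0.
Proof. by move=> detA; apply: tangent_line => t; rewrite scaler0 addr0. Qed.

Theorem corollary5p6 (R : realType) (A : R -> 'M[R]_2)
    (A_SL2 : forall t : R, SL2 (A t))
    (A_C0 : continuous A)
    (A_C2 : is_Ck 2 A) :
  geodesic SL2 A <->
  exists lambda : R -> R,
    continuous lambda /\
    forall t : R, A^`(2) t = lambda t *: cof (A t).
Proof.
split=> [geoA|[lambda [_ A2E]] t].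
  exists (fun t => ((A t)^T *m derive1n 2 A t) 0 0); split; last first.
    move=> t; apply: orth_tangent_SL2 => // B TB.
    by have [_ /(_ B TB)] := geoA t; rewrite subr0.
  (* Continuity of lambda, by expanding the matrix product entrywise. *)
  have entry_cont (M : R -> 'M[R]_2) i j :
      continuous M -> continuous (fun t => M t i j).
    by move=> Mc t; apply: (@continuous_comp _ _ _ M (fun N => N i j));
      [exact: Mc | exact: coord_continuous].
  have A2c : continuous (derive1n 2 A) by have [_] := A_C2; apply.
  have -> : (fun t => ((A t)^T *m derive1n 2 A t) 0 0) =
      (fun t => A t 0 0 * derive1n 2 A t 0 0 + A t 1 0 * derive1n 2 A t 1 0).
    by apply/funext => t; rewrite !(sum_ord2, mxE).
  by move=> t; apply: cvgD; apply: cvgM; exact: entry_cont.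
split; first exact: tangent_SL2_0.
move=> B TB; rewrite subr0 -[derive1 _ t]/(derive1n 2 A t) A2E frobeniusZl.
by rewrite tangent_SL2_orth_cof// mulr0.
Qed.
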